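(* Let $\phi\in\Phi$, $\nu>0$, $\lambda>0$, $f:\mathbb{R}^{n_1\times n_2}\times\mathbb{R}^{n_1\times n_2}\to(-\infty,+\infty]$ proper lsc, $\Omega$ closed, and suppose $\min_{(X,Y)\in\Omega}\{\nu f(X,Y)+\mathrm{rank}(X)+\lambda\|Y\|_0\}$ has a nonempty global optimal solution set. Suppose $f$ is Lipschitz relative to $\Omega$ with constant $L_f>0$ (w.r.t. the Frobenius norm on the product) and $(X^\varrho,Y^\varrho)\in\Omega$ for all $(X,Y)\in\Omega$, $\varrho>0$. Let $\bar\varrho=\frac{\phi'_-(1)(1-t^* )\nu L_f}{(1-t_0)\min(1,\lambda)}$. Consider the MPEC $(Q)$: minimize $F(X,W,Y,S):=\nu f(X,Y)+\sum_{i=1}^{n_1}\phi(\sigma_i(W))+\lambda\sum_{i,j}\phi(|S_{ij}|)$ subject to $\|X\|_*-\langle W,X\rangle+\lambda(\|Y\|_1-\langle Y,S\rangle)=0$, $\|W\|\le1$, $\|S\|_\infty\le1$, $(X,Y)\in\Omega$. Then for all $(X,Y)\in\Omega$, $\|W\|\le1$, $\|S\|_\infty\le1$, $F+\bar\varrho(\|X\|_*-\langle W,X\rangle+\lambda(\|Y\|_1-\langle Y,S\rangle))$ is at least the optimal value of $(Q)$, and for every $\varrho>\bar\varrho$ the set of global optimal solutions of $\min\{F+\varrho(\|X\|_*-\langle W,X\rangle+\lambda(\|Y\|_1-\langle Y,S\rangle)):\ \|W\|\le1,\|S\|_\infty\le1,(X,Y)\in\Omega\}$ coincides with that of $(Q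)$.
   Context: $\Phi$ is the family of proper lsc functions $\phi:\mathbb{R}\to(-\infty,+\infty]$ with $\mathrm{int}(\mathrm{dom}\,\phi)\supseteq[0,1]$, convex on $[0,1]$, such that $\min_{t\in[0,1]}\phi(t)=0$ is attained at a (fixed) point $t^*\in[0,1)$, and $\phi(1)=1$; $\phi'_-(1)$ is the left derivative at $1$. $\psi(t)=\phi(t)$ on $[0,1]$, $+\infty$ otherwise; $t_0\in[0,1)$ is a point with $\frac{1}{1-t^*}\in\partial\psi(t_0)$. Norm notation: nuclear $\|\cdot\|_*$, spectral $\|\cdot\|$, max-abs-entry $\|\cdot\|_\infty$, entrywise $\|\cdot\|_1$, $\|\cdot\|_0$ counts nonzeros; $\sigma_i$ $i$-th largest singular value ($n_1\le n_2$). For $X$ with SVD $U[\mathrm{Diag}(\sigma(X))\ 0]V^T$: $X^\varrho:=U[\mathrm{Diag}(x^\varrho)\ 0]V^T$ with $x^\varrho_i=\sigma_i(X)$ if $\varrho\sigma_i(X)>\phi'_-(1)$, else $0$. $Y^\varrho_{ij}=Y_{ij}$ if $\varrho|Y_{ij}|>\phi'_-(1)$, else $0$. *)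

(* Defs.v *)
From mathcomp Require Import all_boot.
From Stdlib Require Import Reals ClassicalEpsilon.
Set Implicit Arguments. Unset Strict Implicit.
Local Open Scope R_scope.

Inductive ereal := Fin (x : R) | PInf.

Definition eadd (a b : ereal) : ereal :=
  match a, b with Fin x, Fin y => Fin (x + y) | _, _ => PInf end.
(* scaling by a (positive) real *)
Definition escale (c : R) (a : ereal) : ereal :=
  match a with Fin x => Fin (c * x) | PInf => PInf end.
Definition ele (a b : ereal) : Prop :=
  match a, b with
  | Fin x, Fin y => x <= y | _, PInf => True | PInf, Fin _ => False end.
Definition elt (a b : ereal) : Prop :=
  match a, b with
  | Fin x, Fin y => x < y | Fin _, PInf => True | PInf, _ => False end.

Definition rmat (m n : nat) := 'I_m -> 'I_n -> R.

Definition rsum (n : nat) (F : 'I_n -> R) : R := \big[Rplus/0%R]_(i < n) F i.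
Definition rmax (n : nat) (F : 'I_n -> R) : R := \big[Rmax/0%R]_(i < n) F i.

Definition mmul (m n p : nat) (A : rmat m n) (B : rmat n p) : rmat m p :=
  fun i k => rsum (fun j => A i j * B j k).
Definition trmx' (m n : nat) (A : rmat m n) : rmat n m := fun j i => A i j.
Definition orthogonal (n : nat) (U : rmat n n) : Prop :=
  forall i k, mmul (trmx' U) U i k = if i == k then 1 else 0.

Definition diag_blk (n1 n2 : nat) (s : 'I_n1 -> R) : rmat n1 n2 :=
  fun i j => if nat_of_ord i == nat_of_ord j then s i else 0.

Definition is_svd (n1 n2 : nat) (X : rmat n1 n2) (s : 'I_n1 -> R)
  (U : rmat n1 n1) (V : rmat n2 n2) : Prop :=
  orthogonal U /\ orthogonal V /\ (forall i, 0 <= s i) /\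
  (forall i j : 'I_n1, leq i j -> s j <= s i) /\
  X = mmul (mmul U (@diag_blk n1 n2 s)) (trmx' V).

Definition svd_triple (n1 n2 : nat) :=
  (('I_n1 -> R) * rmat n1 n1 * rmat n2 n2)%type.
Lemma svd_triple_inh n1 n2 : inhabited (svd_triple n1 n2).
Proof. exact: (inhabits ((fun _ => 0), (fun _ _ => 0), (fun _ _ => 0))). Qed.

Definition svd (n1 n2 : nat) (X : rmat n1 n2) : svd_triple n1 n2 :=
  epsilon (svd_triple_inh n1 n2)
    (fun t => is_svd X t.1.1 t.1.2 t.2).

(* sigma_i(X), i-th largest singular value (0-based index) *)
Definition sing (n1 n2 : nat) (X : rmat n1 n2) : 'I_n1 -> R := (svd X).1.1.

Definition nucnorm n1 n2 (X : rmat n1 n2) : R := rsum (sing X).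
Definition specnorm n1 n2 (X : rmat n1 n2) : R := rmax (sing X).
Definition maxabs n1 n2 (Y : rmat n1 n2) : R :=
  rmax (fun i => rmax (fun j => Rabs (Y i j))).
Definition l1norm n1 n2 (Y : rmat n1 n2) : R :=
  rsum (fun i => rsum (fun j => Rabs (Y i j))).
Definition l0norm n1 n2 (Y : rmat n1 n2) : R :=
  rsum (fun i => rsum (fun j => if Req_EM_T (Y i j) 0 then 0 else 1)).
Definition inner n1 n2 (A B : rmat n1 n2) : R :=
  rsum (fun i => rsum (fun j => A i j * B i j)).

Definition lin_indep_cols n1 n2 r (X : rmat n1 n2) (g : 'I_r -> 'I_n2) : Prop :=
  forall c : 'I_r -> R,
    (forall i, rsum (fun k => c k * X i (g k)) = 0) -> forall k, c k = 0.
Definition is_rank n1 n2 (X : rmat n1 n2) (r : nat) : Prop :=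
  (exists g : 'I_r -> 'I_n2, lin_indep_cols X g) /\
  (forall r' (g : 'I_r' -> 'I_n2), lin_indep_cols X g -> leq r' r).
Definition rank n1 n2 (X : rmat n1 n2) : nat :=
  epsilon (inhabits O) (fun r => is_rank X r).

(* X^rho and Y^rho; d stands for phi'_-(1) *)
Definition Xrho n1 n2 (d rho : R) (X : rmat n1 n2) : rmat n1 n2 :=
  let: (s, U, V) := svd X in
  mmul (mmul U (@diag_blk n1 n2 (fun i =>
          if Rlt_dec d (rho * s i) then s i else 0))) (trmx' V).
Definition Yrho n1 n2 (d rho : R) (Y : rmat n1 n2) : rmat n1 n2 :=
  fun i j => if Rlt_dec d (rho * Rabs (Y i j)) then Y i j else 0.

Definition pdist n1 n2 (p q : rmat n1 n2 * rmat n1 n2) : R :=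
  sqrt (rsum (fun i => rsum (fun j => (p.1 i j - q.1 i j) ^ 2)) +
        rsum (fun i => rsum (fun j => (p.2 i j - q.2 i j) ^ 2))).

Definition closed_pairset n1 n2 (Om : rmat n1 n2 * rmat n1 n2 -> Prop) : Prop :=
  forall p, ~ Om p -> exists delta, 0 < delta /\
    forall q, pdist p q < delta -> ~ Om q.

Definition proper_fun (T : Type) (f : T -> ereal) : Prop := exists p, f p <> PInf.

Definition lsc_pair n1 n2 (f : rmat n1 n2 * rmat n1 n2 -> ereal) : Prop :=
  forall p (r : R), elt (Fin r) (f p) -> exists delta, 0 < delta /\
    forall q, pdist p q < delta -> elt (Fin r) (f q).

Definition lsc_R (phi : R -> ereal) : Prop :=
  forall x (r : R), elt (Fin r) (phi x) -> exists delta, 0 < delta /\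
    forall y, Rabs (y - x) < delta -> elt (Fin r) (phi y).

Definition lipschitz_rel n1 n2 (f : rmat n1 n2 * rmat n1 n2 -> ereal)
  (Om : rmat n1 n2 * rmat n1 n2 -> Prop) (L : R) : Prop :=
  (forall p, Om p -> f p <> PInf) /\
  forall p q x y, Om p -> Om q -> f p = Fin x -> f q = Fin y ->
    Rabs (x - y) <= L * pdist p q.

Definition in01 (t : R) := 0 <= t <= 1.
Definition rval (a : ereal) : R := match a with Fin x => x | PInf => 0 end.

Definition in_Phi (phi : R -> ereal) (tstar : R) : Prop :=
  proper_fun phi /\ lsc_R phi /\
  (forall t, in01 t -> exists delta, 0 < delta /\
      forall y, Rabs (y - t) < delta -> phi y <> PInf) /\
  (forall s t th, in01 s -> in01 t -> in01 th ->
      ele (phi (th * s + (1 - th) * t))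
          (eadd (escale th (phi s)) (escale (1 - th) (phi t)))) /\
  0 <= tstar < 1 /\ phi tstar = Fin 0 /\
  (forall t, in01 t -> ele (Fin 0) (phi t)) /\
  phi 1 = Fin 1.

Definition is_left_deriv1 (phi : R -> ereal) (d : R) : Prop :=
  forall eps, 0 < eps -> exists delta, 0 < delta /\
    forall h, 0 < h < delta ->
      Rabs ((rval (phi 1) - rval (phi (1 - h))) / h - d) < eps.

Definition psi_of (phi : R -> ereal) (t : R) : ereal :=
  match Rle_dec 0 t, Rle_dec t 1 with
  | left _, left _ => phi t | _, _ => PInf end.

Definition in_subdiff (h : R -> ereal) (x g : R) : Prop :=
  h x <> PInf /\ forall y, ele (eadd (h x) (Fin (g * (y - x)))) (h y).

Definition glob_opt (T : Type) (P : T -> Prop) (h : T -> ereal) (z : T) : Prop :=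
  P z /\ forall z', P z' -> ele (h z) (h z').

(* inf_{z : P z} h z <= a *)
Definition inf_le (T : Type) (P : T -> Prop) (h : T -> ereal) (a : ereal) : Prop :=
  forall r : R, elt a (Fin r) -> exists z, P z /\ elt (h z) (Fin r).

Definition esum (n : nat) (F : 'I_n -> ereal) : ereal :=
  \big[eadd/Fin 0]_(i < n) F i.

Definition quad n1 n2 := (rmat n1 n2 * rmat n1 n2 * rmat n1 n2 * rmat n1 n2)%type.
Definition zX n1 n2 (z : quad n1 n2) := z.1.1.1.
Definition zW n1 n2 (z : quad n1 n2) := z.1.1.2.
Definition zY n1 n2 (z : quad n1 n2) := z.1.2.
Definition zS n1 n2 (z : quad n1 n2) := z.2.

Definition Fobj n1 n2 (nu lam : R) (f : rmat n1 n2 * rmat n1 n2 -> ereal)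
  (phi : R -> ereal) (z : quad n1 n2) : ereal :=
  eadd (eadd (escale nu (f (zX z, zY z))) (esum (fun i => phi (sing (zW z) i))))
       (escale lam (esum (fun i => esum (fun j => phi (Rabs (zS z i j)))))).

Definition cstr n1 n2 (lam : R) (z : quad n1 n2) : R :=
  nucnorm (zX z) - inner (zW z) (zX z) + lam * (l1norm (zY z) - inner (zY z) (zS z)).

Definition box_feas n1 n2 (Om : rmat n1 n2 * rmat n1 n2 -> Prop) (z : quad n1 n2) :=
  specnorm (zW z) <= 1 /\ maxabs (zS z) <= 1 /\ Om (zX z, zY z).

Definition Q_feas n1 n2 (lam : R) (Om : rmat n1 n2 * rmat n1 n2 -> Prop)
  (z : quad n1 n2) := cstr lam z = 0 /\ box_feas Om z.

Definition Fpen n1 n2 (nu lam rho : R) (f : rmat n1 n2 * rmat n1 n2 -> ereal)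
  (phi : R -> ereal) (z : quad n1 n2) : ereal :=
  eadd (Fobj nu lam f phi z) (Fin (rho * cstr lam z)).

(* Main.v *)
(** Fix a box-feasible [(X, W, Y, S)] and let [rho] be the threshold [rhobar].

    For [x >= 0] and [t] in [[0, 1]], convexity of [phi] gives
    [phi t + x (1 - t) >= 1] if [x > d], and [>= kappa x] otherwise, where
    [kappa = (1 - t0) / (d (1 - tstar))]: the first bound comes from the left tangent
    at 1, the second from the subgradient at [t0].  Writing [W] in the singular bases
    of [X] yields [<W, X> <= sum_ik s_i(X) a_ik s_k(W)] with [a] doubly substochastic,
    so averaging the scalar bound with the weights [a_ik] gives
      [sum_k phi(s_k(W)) + rho (|X|_* - <W, X>)
         >= #{i | rho s_i(X) > d} + kappa rho sum_{rho s_i(X) <= d} s_i(X)],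
    and likewise entrywise for [(Y, S)].  Since [kappa rho min(1, lam) = nu Lf], the
    residual sums pay for the change of [nu f] when [(X, Y)] is replaced by its truncation
    [(X^rho, Y^rho)].  Completing the truncation by [W'] and [S'] with singular values,
    respectively absolute values, 1 on the kept part and [tstar] elsewhere produces a point
    that is feasible for (Q) and whose objective is at most the penalized value at the
    original point.  Both claims follow, the second because the constraint function is
    nonnegative on the box. *)
Require Import Defs.
From mathcomp Require Import all_boot all_order all_algebra.
From mathcomp Require Import complex polyrcf spectral Rstruct.
Import Order.TTheory GRing.Theory Num.Theory.

(** * Singular value decomposition over a real closed field *)

Module RealSVD.
From mathcomp Require Import ring lra.

Section SVD.
Set Implicit Arguments. Unset Strict Implicit. Unset Printing Implicit Defensive.
Local Open Scope ring_scope.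
Variable F : rcfType.

Lemma mxdotE n (u v : 'rV[F]_n) : (u *m v^T) 0 0 = \sum_i u 0 i * v 0 i.
Proof. by rewrite mxE; apply: eq_bigr => i _; rewrite mxE. Qed.

Lemma mxdot_ge0 n (u : 'rV[F]_n) : 0 <= (u *m u^T) 0 0.
Proof. by rewrite mxdotE sumr_ge0 // => i _; rewrite -expr2 sqr_ge0. Qed.

Lemma mxdot_eq0 n (u : 'rV[F]_n) : ((u *m u^T) 0 0 == 0) = (u == 0).
Proof.
apply/eqP/eqP => [|->]; last by rewrite mul0mx mxE.
rewrite mxdotE => /psumr_eq0P u0; apply/rowP => i; rewrite mxE.
by apply/eqP; rewrite -sqrf_eq0 expr2 u0 // => j _; rewrite -expr2 sqr_ge0.
Qed.

(** * Eigenvalues of symmetric matrices and Householder reflections *)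

(** Over the complex extension of [F], [A] has an eigenvector [x + i y] with eigenvalue [p + i q].
    Symmetry equates [x A y^T] with [y A x^T], which forces [q (|x|^2 + |y|^2) = 0]; so [q = 0] and
    whichever of [x], [y] is nonzero is an eigenvector for [p]. *)
Lemma sym_eigenvalue_exists n (A : 'M[F]_n.+1) :
  A^T = A -> exists a, eigenvalue A a.
Proof.
move=> symA.
have [c /eigenvalueP[v vA v0]] :=
  @eigenvalue_closed (complex F) n.+1 (map_mx (real_complex F) A) isT.
pose x : 'rV[F]_n.+1 := map_mx (@complex.Re F) v.
pose y : 'rV[F]_n.+1 := map_mx (@complex.Im F) v.
pose p := complex.Re c; pose q := complex.Im c.
have re_sum (G : 'I_n.+1 -> complex F) : complex.Re (\sum_i G i) = \sum_i complex.Re (G i).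
  by rewrite raddf_sum.
have im_sum (G : 'I_n.+1 -> complex F) : complex.Im (\sum_i G i) = \sum_i complex.Im (G i).
  by rewrite raddf_sum.
have xA : x *m A = p *: x - q *: y.
  apply/rowP => j; have /rowP/(_ j) := vA; rewrite !mxE => /(congr1 (@complex.Re F)).
  rewrite re_sum.
  have -> : complex.Re (c * v 0 j) = p * complex.Re (v 0 j) - q * complex.Im (v 0 j).
    by rewrite /p /q; case: c (v 0 j) {vA p q} => ? ? [].
  move=> <-; apply: eq_bigr => i _; rewrite !mxE.
  by case: (v 0 i) => a b /=; rewrite mulr0 subr0.
have yA : y *m A = p *: y + q *: x.
  apply/rowP => j; have /rowP/(_ j) := vA; rewrite !mxE => /(congr1 (@complex.Im F)).
  rewrite im_sum.
  have -> : complex.Im (c * v 0 j) = p * complex.Im (v 0 j) + q * complex.Re (v 0 j).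
    by rewrite /p /q; case: c (v 0 j) {vA xA p q} => ? ? [] ? ? /=; ring.
  move=> <-; apply: eq_bigr => i _; rewrite !mxE.
  by case: (v 0 i) => a b /=; rewrite mulr0 add0r.
have xy0 : (x != 0) || (y != 0).
  apply/negPn/negP; rewrite negb_or !negbK => /andP[/eqP x0 /eqP y0].
  case/eqP: v0; apply/rowP => i; rewrite mxE.
  have /rowP/(_ i) := x0; have /rowP/(_ i) := y0; rewrite !mxE.
  by case: (v 0 i) => a b /= -> ->.
have q0 : q = 0.
  have : (x *m A *m y^T) 0 0 = (y *m A *m x^T) 0 0.
    rewrite -[in RHS](trmxK (y *m A *m x^T)) [RHS]mxE !trmx_mul symA trmxK.
    by rewrite mulmxA.
  rewrite xA yA !(mulmxBl, mulmxDl) -!scalemxAl.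
  have -> : y *m x^T = x *m y^T.
    by apply/rowP => i; rewrite ord1 !mxdotE; apply: eq_bigr => k _; rewrite mulrC.
  rewrite [LHS]mxE [RHS]mxE [in X in _ + X = _]mxE => /addrI.
  rewrite [in X in - X]mxE [in RHS]mxE => /eqP; rewrite eq_sym -addr_eq0.
  rewrite -mulrDr mulf_eq0 => /orP[/eqP//|].
  rewrite paddr_eq0 ?mxdot_ge0 // !mxdot_eq0 => /andP[/eqP x0 /eqP y0].
  by move: xy0; rewrite x0 y0 eqxx.
move: xA yA; rewrite q0 !scale0r addr0 subr0 => xA yA.
exists p; apply/eigenvalueP.
by case/orP: xy0 => ?; [exists x|exists y].
Qed.

(** The eigenvalues are the members of the finite list of roots of the characteristic polynomial,
    which is nonempty by the previous lemma. *)
Lemma sym_max_eigenvalue n (A : 'M[F]_n.+1) : A^T = A ->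
  exists2 a, eigenvalue A a & forall b, eigenvalue A b -> b <= a.
Proof.
move=> /sym_eigenvalue_exists[a0 a0P].
have p0 : char_poly A != 0 by rewrite monic_neq0 // char_poly_monic.
have inr b : eigenvalue A b = (b \in rootsR (char_poly A)).
  have := roots_on_rootsR p0; move/(_ b); rewrite eigenvalue_root_char.
  by rewrite in_itv /= => ->.
have [a ain amax] : exists2 a, a \in rootsR (char_poly A) &
    forall b, b \in rootsR (char_poly A) -> b <= a.
  have : rootsR (char_poly A) != [::].
    by apply/eqP => E; move: a0P; rewrite inr E.
  elim: (rootsR _) => // x [|y s] IH _.
    by exists x; rewrite ?inE // => b; rewrite inE => /eqP->.
  have [//|a ain amax] := IH; have [xa|ax] := lerP x a.
    exists a; first by rewrite inE ain orbT.
    by move=> b; rewrite inE => /orP[/eqP->//|/amax].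
  exists x; first by rewrite inE eqxx.
  move=> b; rewrite inE => /orP[/eqP->//|/amax ba].
  exact: le_trans ba (ltW ax).
by exists a => [|b]; rewrite inr // => /amax.
Qed.

(** [H] is the Householder reflection along [w = u - e], which exchanges [e] and [u]. The case
    [u = e] is set apart because the reflection divides by [|w|^2]. *)
Lemma unit_row_orthogonal n (u : 'rV[F]_n.+1) : (u *m u^T) 0 0 = 1 ->
  exists2 H : 'M[F]_n.+1, H^T *m H = 1%:M & delta_mx 0 0 *m H = u.
Proof.
move=> u1; pose e : 'rV[F]_n.+1 := delta_mx 0 0.
have [->|ue] := eqVneq u e; first by exists 1%:M; rewrite ?trmx1 mulmx1.
pose w := u - e; pose N := (w *m w^T) 0 0.
have N0 : N != 0 by rewrite mxdot_eq0 subr_eq0.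
have NE : w *m w^T = N%:M by apply/rowP=> i; rewrite ord1 [RHS]mxE.
have e0 k : e 0 k = (k == 0)%:R by rewrite mxE eqxx.
have ewE : (e *m w^T) 0 0 = u 0 0 - 1.
  rewrite mxdotE (bigD1 ord0) //= big1 ?addr0 => [|k k0].
    by rewrite !mxE eqxx mul1r.
  by rewrite e0 (negPf k0) mul0r.
have uwE : (u *m w^T) 0 0 = 1 - u 0 0.
  rewrite /w linearB /= mulmxBr mxE u1 [in LHS]mxE mxdotE.
  rewrite (bigD1 ord0) //= big1 ?addr0 => [|k k0].
    by rewrite e0 eqxx mulr1.
  by rewrite e0 (negPf k0) mulr0.
have NuE : N = 2 * (1 - u 0 0).
  rewrite /N {1}/w mulmxBl mxE uwE [in LHS]mxE ewE; ring.
exists (1%:M - (2 / N) *: (w^T *m w)).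
  pose P := w^T *m w.
  have PP : P *m P = N *: P.
    by rewrite /P mulmxA -(mulmxA w^T) NE mul_mx_scalar -scalemxAl.
  have -> : (1%:M - (2 / N) *: P)^T = 1%:M - (2 / N) *: P.
    by rewrite raddfB /= trmx1 linearZ /= /P trmx_mul trmxK.
  rewrite mulmxBl mul1mx -/P -scalemxAl mulmxBr mulmx1 -scalemxAr PP.
  rewrite scalerA divfK // scaler_nat mulr2n opprD addrA subrr add0r.
  by rewrite scalerN opprK subrK.
rewrite mulmxBr mulmx1 -scalemxAr mulmxA.
have -> : e *m w^T = (u 0 0 - 1)%:M by apply/rowP=> i; rewrite ord1 [RHS]mxE ewE.
rewrite mul_scalar_mx scalerA; have -> : 2 / N * (u 0 0 - 1) = -1.
  by move: N0; rewrite NuE => N0; field; move: N0; rewrite mulf_eq0 negb_or => /andP[].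
by rewrite scaleN1r opprK addrC subrK.
Qed.

(** * Existence of the decomposition and uniqueness of singular values *)

Definition rect_diag m n (s : 'I_m -> F) : 'M[F]_(m, n) :=
  \matrix_(i, j) (s i *+ (i == j :> nat)).

Lemma mul_rect_diag m n (mn : (m <= n)%N) p (s : 'I_m -> F) (B : 'M[F]_(n, p)) i j :
  (rect_diag n s *m B) i j = s i * B (widen_ord mn i) j.
Proof.
rewrite mxE (bigD1 (widen_ord mn i)) //= mxE eqxx mulr1n big1 ?addr0 // => k ki.
rewrite mxE; case: eqVneq => [E|]; last by rewrite mulr0n mul0r.
by case/eqP: ki; apply: val_inj.
Qed.

Lemma mul_tr_rect_diag m n (mn : (m <= n)%N) p (s : 'I_m -> F) (B : 'M[F]_(p, n)) i j :
  (B *m (rect_diag n s)^T) i j = B i (widen_ord mn j) * s j.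
Proof.
by rewrite -[_ *m _]trmxK mxE trmx_mul trmxK (mul_rect_diag mn) mxE mulrC.
Qed.

Lemma rect_diag_mul_tr m n (mn : (m <= n)%N) (s t : 'I_m -> F) :
  rect_diag n s *m (rect_diag n t)^T = diag_mx (\row_i (s i * t i)).
Proof.
apply/matrixP => i j; rewrite (mul_tr_rect_diag mn) !mxE /= mulrnAl.
by rewrite (inj_eq val_inj); case: eqP => [->|].
Qed.

Definition SVD m n (X : 'M[F]_(m, n)) (s : 'I_m -> F) (U : 'M_m) (V : 'M_n) :=
  [/\ U^T *m U = 1%:M, V^T *m V = 1%:M, forall i, 0 <= s i,
      forall i j : 'I_m, (i <= j)%N -> s j <= s i & X = U *m rect_diag n s *m V^T].

Lemma SVD_gram m n (mn : (m <= n)%N) (X : 'M[F]_(m, n)) s U V :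
  SVD X s U V -> X *m X^T = U *m diag_mx (\row_i (s i * s i)) *m U^T.
Proof.
move=> [_ VV _ _ ->]; rewrite !trmx_mul trmxK -!mulmxA (mulmxA _ V) VV mul1mx.
by congr (_ *m _); rewrite !mulmxA rect_diag_mul_tr.
Qed.

(** Take a unit eigenvector [u] for the largest eigenvalue [a] of [X X^T], [sg = sqrt a] and
    [v = u X / sg]. The final bound is what later keeps the singular values ordered. *)
Lemma singular_pair m n (X : 'M[F]_(m.+1, n.+1)) : (m <= n)%N ->
  exists (sg : F) (u : 'rV_m.+1) (v : 'rV_n.+1),
  [/\ 0 <= sg, (u *m u^T) 0 0 = 1, (v *m v^T) 0 0 = 1,
      u *m X = sg *: v & v *m X^T = sg *: u] /\
  forall b, eigenvalue (X *m X^T) b -> b <= sg * sg.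
Proof.
move=> mn; have symXX : (X *m X^T)^T = X *m X^T by rewrite trmx_mul trmxK.
have [a /eigenvalueP[u uA u0] amax] := sym_max_eigenvalue symXX.
have normalize k (w : 'rV[F]_k) : w != 0 ->
    exists2 c, c != 0 & ((c *: w) *m (c *: w)^T) 0 0 = 1.
  move=> w0; pose N := (w *m w^T) 0 0.
  have Ngt0 : 0 < N by rewrite lt_def mxdot_eq0 w0 mxdot_ge0.
  have sN : Num.sqrt N != 0 by rewrite sqrtr_eq0 -ltNge.
  exists (Num.sqrt N)^-1; first by rewrite invr_eq0.
  rewrite linearZ /= -scalemxAl -scalemxAr 2!mxE -/N -[X in _ * (_ * X)]sqr_sqrtr ?ltW //.
  by rewrite expr2 mulKf // mulVf.
have [c c0] := normalize _ _ u0; set u1 := c *: u => u11.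
have u1A : u1 *m X *m X^T = a *: u1.
  by rewrite -mulmxA -scalemxAl uA !scalerA mulrC.
have aE : a = ((u1 *m X) *m (u1 *m X)^T) 0 0.
  by rewrite trmx_mul mulmxA u1A -scalemxAl mxE u11 mulr1.
have a_ge0 : 0 <= a by rewrite aE mxdot_ge0.
have [a0|an0] := eqVneq a 0.
  have u1X : u1 *m X = 0 by apply/eqP; rewrite -mxdot_eq0 -aE a0.
  (* For [a = 0] the formula for [v] is void, and any unit [v] with [v X^T = 0] will do. One exists
     because [u1 X = 0] with [u1] nonzero pushes the rank of [X] below [m + 1 <= n + 1]. *)
  have : kermx X^T != 0.
    rewrite -mxrank_eq0 mxrank_ker mxrank_tr -lt0n subn_gt0.
    have [/leq_trans->//|rX] := ltnP (\rank X) m.+1.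
    have freeX : row_free X by rewrite -row_leq_rank.
    have u10 : u1 = 0 by apply: (row_free_inj freeX); rewrite mul0mx.
    by move: u11; rewrite u10 mul0mx mxE => /esym/eqP; rewrite oner_eq0.
  case/rowV0Pn => v /sub_kermxP vX v0; have [e e0 ev1] := normalize _ _ v0.
  exists 0, u1, (e *: v); split; first by split; rewrite ?scale0r // -scalemxAl vX scaler0.
  by move=> b /amax; rewrite a0 mulr0.
have sg0 : Num.sqrt a != 0 by rewrite sqrtr_eq0 -ltNge lt_def an0.
have sgE : Num.sqrt a * Num.sqrt a = a by rewrite -expr2 sqr_sqrtr.
exists (Num.sqrt a), u1, ((Num.sqrt a)^-1 *: (u1 *m X)); split; last by rewrite sgE.
split=> //.
- by rewrite sqrtr_ge0.
- rewrite linearZ /= -scalemxAl -scalemxAr 2!mxE -aE -{3}sgE.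
  by rewrite mulKf // mulVf.
- by rewrite scalerA divff // scale1r.
- by rewrite -scalemxAl u1A scalerA -{2}sgE mulKf.
Qed.

(** Induction on the number of rows: rotating a top singular pair onto the first coordinate vectors
    leaves [sg] in the corner and a smaller block, to which the induction hypothesis applies. *)
Lemma SVD_exists m n (X : 'M[F]_(m, n)) : (m <= n)%N ->
  exists s U V, SVD X s U V.
Proof.
elim: m n X => [|m IH] n X.
  move=> _; exists (fun=> 0), 1%:M, 1%:M; split; rewrite ?trmx1 ?mulmx1 //.
  by apply/matrixP => [[]].
case: n X => [//|n] X.
rewrite ltnS => mn.
have [sg [u [v [[sg0 u1 v1 uX vX] sgmax]]]] := singular_pair X mn.
have [U1 U1o U1u] := unit_row_orthogonal u1.
have [V1 V1o V1v] := unit_row_orthogonal v1.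
have U1o' := mulmx1C U1o; have V1o' := mulmx1C V1o.
have [M MdE] : exists M : 'M[F]_(1 + m, 1 + n), M = U1 *m X *m V1^T by eexists.
pose e k : 'rV[F]_(1 + k) := delta_mx 0 0.
have eM : e m *m M = sg *: e n.
  by rewrite MdE !mulmxA U1u uX -scalemxAl -V1v -mulmxA V1o' mulmx1.
have eMt : e n *m M^T = sg *: e m.
  rewrite MdE !trmx_mul trmxK !mulmxA V1v.
  by rewrite vX -scalemxAl -U1u -mulmxA U1o' mulmx1.
have lshift0 k : lshift k (0 : 'I_1) = 0 by apply: val_inj.
have ME : M = block_mx sg%:M 0 0 (drsubmx M).
  rewrite -[LHS]submxK; congr block_mx; apply/matrixP => i j.
  - have /rowP/(_ (lshift n j)) := eM; rewrite -rowE !mxE.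
    by rewrite !ord1 !lshift0 => ->; rewrite !eqxx mulr1.
  - have /rowP/(_ (rshift 1 j)) := eM; rewrite -rowE !mxE.
    by rewrite !ord1 !lshift0 => ->; rewrite mulr0.
  - have /rowP/(_ (rshift 1 i)) := eMt; rewrite -rowE !mxE.
    by rewrite !ord1 !lshift0 => ->; rewrite mulr0.
have [s' [U' [V' [U'o V'o s'0 s's X'E]]]] := IH n (drsubmx M) mn.
pose s (i : 'I_(1 + m)) := if split i is inr j then s' j else sg.
pose ext k (A : 'M[F]_k) : 'M[F]_(1 + k) := block_mx (1%:M : 'M_1) 0 0 A.
pose U : 'M_(1 + m) := (U1^T : 'M_(1 + m)) *m ext m U'.
pose V : 'M_(1 + n) := (V1^T : 'M_(1 + n)) *m ext n V'.
have dE : rect_diag (1 + n) s = block_mx sg%:M 0 0 (rect_diag n s').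
  apply/matrixP => i j; rewrite mxE /s.
  case: (split_ordP i) => i' ->; case: (split_ordP j) => j' ->.
  - by rewrite block_mxEul !mxE !ord1.
  - by rewrite block_mxEur !mxE !ord1.
  - by rewrite block_mxEdl !mxE !ord1.
  - by rewrite block_mxEdr !mxE.
have blk k (A B : 'M[F]_k) : A^T *m B = 1%:M ->
    (ext k A)^T *m ext k B = 1%:M.
  move=> AB; rewrite /ext tr_block_mx !trmx0 trmx1 mulmx_block AB.
  by rewrite !(mulmx0, mul0mx, addr0, add0r, mulmx1) -scalar_mx_block.
have Uo : U^T *m U = 1%:M.
  by rewrite trmx_mul trmxK -mulmxA (mulmxA U1) U1o' mul1mx blk.
have Vo : V^T *m V = 1%:M.
  by rewrite trmx_mul trmxK -mulmxA (mulmxA V1) V1o' mul1mx blk.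
have XE : X = U *m rect_diag (1 + n) s *m V^T.
  have -> : X = U1^T *m M *m V1.
    by rewrite MdE !mulmxA U1o mul1mx -mulmxA V1o mulmx1.
  rewrite /U /V trmx_mul trmxK -!mulmxA; congr (_ *m _); rewrite !mulmxA; congr (_ *m _).
  rewrite dE {1}ME X'E /ext tr_block_mx !trmx0 trmx1 !mulmx_block.
  by rewrite !(mulmx0, mul0mx, addr0, add0r, mulmx1, mul1mx).
have s_ge0 i : 0 <= s i by rewrite /s; case: split.
clearbody U V; exists s, U, V; split=> //.
have gram : U^T *m (X *m X^T) = diag_mx (\row_i (s i * s i)) *m U^T.
  rewrite XE !trmx_mul trmxK -!mulmxA (mulmxA U^T) Uo mul1mx (mulmxA V^T) Vo mul1mx.
  by rewrite !mulmxA (@rect_diag_mul_tr m.+1 n.+1).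
(* The square of [s i] is an eigenvalue of [X X^T], with row [i] of [U^T] as eigenvector, so the
   maximality of [sg] bounds it. *)
have s_le i : s i <= sg.
  rewrite -(@ler_pXn2r _ 2) ?nnegrE // !expr2; apply: sgmax.
  apply/eigenvalueP; exists (row i U^T).
    by rewrite -row_mul gram; apply/rowP => j; rewrite mxE mul_diag_mx !mxE.
  apply/eqP => r0; have : row i (U^T *m U) = 0 by rewrite row_mul r0 mul0mx.
  by rewrite Uo => /rowP/(_ i); rewrite !mxE eqxx => /eqP; rewrite oner_eq0.
move=> i j; have := s_le j; rewrite /s.
case: (@split_ordP 1 m i) => i' -> //.
by case: (@split_ordP 1 m j) => j' -> //= _; rewrite ?ord1 // leq_add2l; apply: s's.
Qed.

(** The orthogonal matrix [P = U^T U'] intertwines the two diagonalisations of [X X^T], so [P i k]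
    vanishes unless [s i = s' k]. The squares of its entries are doubly stochastic, and summing
    against them transports any [h]. Letting [h] be arbitrary expresses equality of the singular
    values with multiplicity. *)
Lemma SVD_sum_unique m n (mn : (m <= n)%N) (X : 'M[F]_(m, n)) s U V s' U' V'
    (h : F -> F) :
  SVD X s U V -> SVD X s' U' V' -> \sum_i h (s i) = \sum_i h (s' i).
Proof.
move=> S S'; have G := SVD_gram mn S; have G' := SVD_gram mn S'.
case: S S' => [Uo _ s0 _ _] [Uo' _ s0' _ _].
pose P := U^T *m U'.
have Po : P^T *m P = 1%:M.
  by rewrite trmx_mul trmxK -mulmxA (mulmxA U) (mulmx1C Uo) mul1mx.
have DP : diag_mx (\row_i (s i * s i)) *m P = P *m diag_mx (\row_i (s' i * s' i)).
  have : U^T *m (X *m X^T) *m U' = U^T *m (X *m X^T) *m U' by [].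
  rewrite {1}G G' -!mulmxA Uo' mulmx1 (mulmxA U^T U) Uo mul1mx !mulmxA.
  by rewrite -mulmxA.
clearbody P.
have hP i k : h (s i) * P i k ^+ 2 = h (s' k) * P i k ^+ 2.
  have /matrixP/(_ i k) := DP; rewrite mul_diag_mx mul_mx_diag !mxE mulrC => /eqP.
  rewrite -subr_eq0 -mulrBr mulf_eq0 => /orP[/eqP P0|].
    by rewrite P0 expr0n !mulr0.
  by rewrite subr_eq0 -!expr2 eqrXn2 // => /eqP ->.
have colP k : \sum_i P i k ^+ 2 = 1.
  have /matrixP/(_ k k) := Po; rewrite !mxE eqxx mulr1n => <-.
  by apply: eq_bigr => i _; rewrite mxE expr2.
have rowP i : \sum_k P i k ^+ 2 = 1.
  have /matrixP/(_ i i) := mulmx1C Po; rewrite !mxE eqxx mulr1n => <-.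
  by apply: eq_bigr => k _; rewrite mxE expr2.
transitivity (\sum_i \sum_k h (s i) * P i k ^+ 2).
  by apply: eq_bigr => i _; rewrite -mulr_sumr rowP mulr1.
rewrite exchange_big /=; apply: eq_bigr => k _.
by under eq_bigr do rewrite hP; rewrite -mulr_sumr colP mulr1.
Qed.

(** * Inner products in singular bases *)

Lemma inner_rect_diag m n (mn : (m <= n)%N) (P U : 'M[F]_m) (Q V : 'M[F]_n)
    (w s : 'I_m -> F) :
  \sum_i \sum_j (P *m rect_diag n w *m Q^T) i j * (U *m rect_diag n s *m V^T) i j =
  \sum_i s i * \sum_k (U^T *m P) i k * (Q^T *m V) (widen_ord mn k) (widen_ord mn i) * w k.
Proof.
set W := P *m _ *m _; set X := U *m _ *m _.
transitivity (\tr (W *m X^T)).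
  by apply: eq_bigr => i _; rewrite mxE; apply: eq_bigr => j _; rewrite !mxE.
rewrite /X !trmx_mul trmxK !mulmxA mxtrace_mulC !mulmxA.
apply: eq_bigr => i _; rewrite (mul_tr_rect_diag mn) mulrC; congr (_ * _).
rewrite -!mulmxA (mulmxA U^T) mxE; apply: eq_bigr => k _.
by rewrite (mul_rect_diag mn); ring.
Qed.

(* The weights are the absolute values of the products of corresponding entries
   of the two orthogonal matrices relating the singular bases; AM-GM bounds their sums. *)
Lemma SVD_inner_le m n (mn : (m <= n)%N) (W X : 'M[F]_(m, n)) w P Q s U V :
  SVD W w P Q -> SVD X s U V ->
  exists a : 'I_m -> 'I_m -> F,
    [/\ forall i k, 0 <= a i k, forall i, \sum_k a i k <= 1,
        forall k, \sum_i a i k <= 1 &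
        \sum_i \sum_j W i j * X i j <= \sum_i s i * \sum_k a i k * w k].
Proof.
move=> [Po Qo w0 _ ->] [Uo Vo s0 _ ->]; rewrite (inner_rect_diag mn).
set A := U^T *m P; set B := Q^T *m V.
have Ao : A^T *m A = 1%:M.
  by rewrite trmx_mul trmxK -mulmxA (mulmxA U) (mulmx1C Uo) mul1mx.
have Bo : B^T *m B = 1%:M.
  by rewrite trmx_mul trmxK -mulmxA (mulmxA Q) (mulmx1C Qo) mul1mx.
clearbody A B.
have colE k (M : 'M[F]_k) i : M^T *m M = 1%:M -> \sum_j M j i ^+ 2 = 1.
  move=> /matrixP/(_ i i); rewrite !mxE eqxx mulr1n => <-.
  by apply: eq_bigr => j _; rewrite mxE expr2.
have rowE k (M : 'M[F]_k) i : M^T *m M = 1%:M -> \sum_j M i j ^+ 2 = 1.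
  move=> /mulmx1C/matrixP/(_ i i); rewrite !mxE eqxx mulr1n => <-.
  by apply: eq_bigr => j _; rewrite mxE expr2.
have widen_le (G : 'I_n -> F) : (forall i, 0 <= G i) ->
    \sum_(i < m) G (widen_ord mn i) <= \sum_i G i.
  move=> G0; rewrite -(big_ord_narrow mn) [leRHS](bigID (fun i : 'I_n => (i < m)%N)) /=.
  by rewrite lerDl sumr_ge0.
pose a i k := `|A i k * B (widen_ord mn k) (widen_ord mn i)|.
have aP i k : a i k <= 2^-1 * (A i k ^+ 2 + B (widen_ord mn k) (widen_ord mn i) ^+ 2).
  rewrite /a normrM -(real_normK (num_real (A i k))).
  rewrite -(real_normK (num_real (B _ _))).
  by have := sqr_ge0 (`|A i k| - `|B (widen_ord mn k) (widen_ord mn i)|); nra.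
exists a; split.
- by move=> i k; rewrite normr_ge0.
- move=> i; apply: (le_trans (ler_sum _ (fun k _ => aP i k))).
  rewrite -mulr_sumr big_split /= rowE //.
  have := widen_le (fun k => B k (widen_ord mn i) ^+ 2) (fun k => sqr_ge0 _).
  by rewrite /= colE //; lra.
- move=> k; apply: (le_trans (ler_sum _ (fun i _ => aP i k))).
  rewrite -mulr_sumr big_split /= colE //.
  have := widen_le (fun i => B (widen_ord mn k) i ^+ 2) (fun i => sqr_ge0 _).
  by rewrite /= rowE //; lra.
- apply: ler_sum => i _; apply: ler_wpM2l => //; apply: ler_sum => k _.
  by apply: ler_wpM2r => //; apply: ler_norm.
Qed.

Lemma inner_rect_diag_same m n (mn : (m <= n)%N) (U : 'M[F]_m) (V : 'M[F]_n)
    (w s : 'I_m -> F) : U^T *m U = 1%:M -> V^T *m V = 1%:M ->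
  \sum_i \sum_j (U *m rect_diag n w *m V^T) i j * (U *m rect_diag n s *m V^T) i j =
  \sum_i w i * s i.
Proof.
move=> Uo Vo; rewrite (inner_rect_diag mn) Uo Vo; apply: eq_bigr => i _.
rewrite (bigD1 i) //= big1 => [|k /negPf ki]; last by rewrite mxE eq_sym ki !mul0r.
by rewrite !mxE !eqxx !mul1r addr0 mulrC.
Qed.

(** Average the bounds on [mu i] over [k] with weights [a i k]. The missing mass [1 - \sum_k a i k]
    of row [i] is covered by [mu i <= x i]; column sums at most 1 and [r >= 0] control the weighted
    sum of [r]. *)
Lemma substochastic_bound m (a : 'I_m -> 'I_m -> F)
    (x w r mu : 'I_m -> F) :
  (forall i k, 0 <= a i k) -> (forall i, \sum_k a i k <= 1) ->
  (forall k, \sum_i a i k <= 1) -> (forall k, 0 <= r k) ->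
  (forall i k, mu i <= r k + x i * (1 - w k)) -> (forall i, mu i <= x i) ->
  \sum_i mu i <= \sum_k r k + (\sum_i x i - \sum_i x i * \sum_k a i k * w k).
Proof.
move=> a0 arow acol r0 murw mux.
have le_r : \sum_i \sum_k a i k * r k <= \sum_k r k.
  rewrite exchange_big; apply: ler_sum => k _ /=; rewrite -mulr_suml.
  by rewrite -[leRHS]mul1r ler_wpM2r.
apply: (@le_trans _ _ (\sum_i \sum_k a i k * r k +
    (\sum_i x i - \sum_i x i * \sum_k a i k * w k))); last by rewrite lerD2r.
rewrite -sumrB -big_split; apply: ler_sum => i _ /=.
have : \sum_k a i k * mu i <= \sum_k a i k * (r k + x i * (1 - w k)).
  by apply: ler_sum => k _; rewrite ler_wpM2l.
have -> : \sum_k a i k * (r k + x i * (1 - w k)) =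
    \sum_k a i k * r k + x i * \sum_k a i k - x i * \sum_k a i k * w k.
  rewrite !mulr_sumr -big_split -sumrB; apply: eq_bigr => k _ /=; ring.
rewrite -mulr_suml; have := arow i; have := mux i.
set A := \sum_k a i k; set B := \sum_k _; set C := \sum_k _.
nra.
Qed.
End SVD.
End RealSVD.
Import RealSVD.

(** * Real matrices as functions *)

From Stdlib Require Import Reals ClassicalEpsilon FunctionalExtensionality Lra.

Section Transfer.
Set Implicit Arguments. Unset Strict Implicit.
Local Open Scope ring_scope.

Definition to_mx m n (A : rmat m n) : 'M[R]_(m, n) := (\matrix_(i, j) A i j).

Lemma to_mxE m n (A : rmat m n) i j : to_mx A i j = A i j.
Proof. by rewrite mxE. Qed.

Lemma to_mx_mmul m n p (A : rmat m n) (B : rmat n p) :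
  to_mx (mmul A B) = (to_mx A *m to_mx B).
Proof. by apply/matrixP => i k; rewrite !mxE; apply: eq_bigr => j _; rewrite !mxE. Qed.

Lemma to_mx_tr m n (A : rmat m n) : to_mx (trmx' A) = ((to_mx A)^T).
Proof. by apply/matrixP => i k; rewrite !mxE. Qed.

Lemma to_mx_diag m n (s : 'I_m -> R) : to_mx (@diag_blk m n s) = rect_diag n s.
Proof. by apply/matrixP => i k; rewrite !mxE /diag_blk; case: eqP. Qed.

Lemma to_mx_inj m n (A B : rmat m n) : to_mx A = to_mx B -> A = B.
Proof.
move=> AB; apply: functional_extensionality => i; apply: functional_extensionality => j.
by have /matrixP/(_ i j) := AB; rewrite !to_mxE.
Qed.

Lemma to_mx_orthogonal n (U : rmat n n) :
  Defs.orthogonal U <-> ((to_mx U)^T *m to_mx U = 1%:M).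
Proof.
rewrite -to_mx_tr -to_mx_mmul; split=> [Uo|Uo i k].
  by apply/matrixP => i k; rewrite to_mxE Uo mxE; case: eqP.
by have /matrixP/(_ i k) := Uo; rewrite to_mxE mxE => ->; case: eqP.
Qed.

Lemma is_svdE m n (X : rmat m n) s U V :
  is_svd X s U V <-> SVD (to_mx X) s (to_mx U) (to_mx V).
Proof.
have XE : X = mmul (mmul U (@diag_blk m n s)) (trmx' V) <->
    to_mx X = (to_mx U *m rect_diag n s *m (to_mx V)^T).
  rewrite -to_mx_diag -to_mx_tr -!to_mx_mmul.
  by split=> [->//|/to_mx_inj].
split.
  move=> [/to_mx_orthogonal Uo [/to_mx_orthogonal Vo [s0 [ss /XE]]]].
  by split=> // [i|i j ij]; apply/RleP; [apply: s0|apply: ss].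
move=> [/to_mx_orthogonal Uo /to_mx_orthogonal Vo s0 ss /XE].
split=> //; split=> //; split; first by move=> i; apply/RleP; apply: s0.
by split=> // i j ij; apply/RleP; apply: ss.
Qed.

(** [svd] is a choice operator, so existence of a decomposition is what gives it meaning. *)
Lemma svdP m n (X : rmat m n) : leq m n ->
  is_svd X (svd X).1.1 (svd X).1.2 (svd X).2.
Proof.
move=> mn; apply: (epsilon_spec (svd_triple_inh m n) (fun t => is_svd X t.1.1 t.1.2 t.2)).
have [s [U [V S]]] := SVD_exists (to_mx X) mn.
exists (s, (fun i j => U i j), (fun i j => V i j)); apply/is_svdE => /=.
have mxK k (A : 'M[R]_k) : to_mx (fun i j => A i j) = A.
  by apply/matrixP => i j; rewrite mxE.
by rewrite !mxK.
Qed.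

(** The decomposition chosen by [svd] may differ from one built by hand; only sums over singular
    values are compared, which suffices for every later use. *)
Lemma sing_rsum m n (X : rmat m n) s U V (h : R -> R) : leq m n ->
  is_svd X s U V -> rsum (fun i => h (sing X i)) = rsum (fun i => h (s i)).
Proof.
by move=> mn S; apply: (SVD_sum_unique mn h _ _); apply/is_svdE; [apply: svdP|apply: S].
Qed.

Lemma inner_svd_same m n (U : rmat m m) (V : rmat n n) (w s : 'I_m -> R) :
  leq m n -> Defs.orthogonal U -> Defs.orthogonal V ->
  inner (mmul (mmul U (@diag_blk m n w)) (trmx' V))
        (mmul (mmul U (@diag_blk m n s)) (trmx' V)) = rsum (fun i => w i * s i).
Proof.
move=> mn /to_mx_orthogonal Uo /to_mx_orthogonal Vo.
rewrite -[RHS](inner_rect_diag_same mn w s Uo Vo).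
apply: eq_bigr => i _; apply: eq_bigr => j _.
by rewrite -!to_mx_diag -!to_mx_tr -!to_mx_mmul !to_mxE.
Qed.

End Transfer.

(** * Trace pairing, finite sums and maxima over the reals *)

Section RealSums.
Set Implicit Arguments. Unset Strict Implicit.
Local Open Scope R_scope.

Lemma mmul_diag_sub m n (U : rmat m m) (V : rmat n n) (w s : 'I_m -> R) i j :
  mmul (mmul U (@diag_blk m n w)) (trmx' V) i j -
  mmul (mmul U (@diag_blk m n s)) (trmx' V) i j =
  mmul (mmul U (@diag_blk m n (fun k => w k - s k))) (trmx' V) i j.
Proof.
rewrite -3!(to_mxE (mmul (mmul U _) _)) !to_mx_mmul !to_mx_diag.
have -> : rect_diag n (fun k => w k - s k) =
    GRing.add (rect_diag n w) (GRing.opp (rect_diag n s)).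
  by apply/matrixP => k l; rewrite !mxE -mulrnBl.
by rewrite mulmxBr mulmxBl [RHS]mxE [X in _ = GRing.add _ X]mxE.
Qed.

(** [r] and [mu] stay abstract to serve twice: for the penalty bound, and with both zero for the
    duality of the nuclear and spectral norms. *)
Lemma trace_pairing_bound m n (W X : rmat m n) (r mu : 'I_m -> R) (rho : R) :
  leq m n -> 0 <= rho -> (forall k, 0 <= r k) ->
  (forall i k, mu i <= r k + rho * sing X i * (1 - sing W k)) ->
  (forall i, mu i <= rho * sing X i) ->
  rsum mu <= rsum r + rho * (nucnorm X - inner W X).
Proof.
move=> mn /RleP rho0 r0 murw mux.
have /is_svdE SW := svdP W mn; have /is_svdE SX := svdP X mn.
have [a [a0 arow acol le_inner]] := SVD_inner_le mn SW SX.
have H := substochastic_bound a0 arow acol (fun k => introT RleP (r0 k))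
  (fun i k => introT RleP (murw i k)) (fun i => introT RleP (mux i)).
apply/RleP; apply: (le_trans H).
rewrite lerD2l RmultE RminusE mulrBr -mulr_sumr lerD2l lerN2.
under eq_bigr do rewrite -mulrA; rewrite -mulr_sumr ler_wpM2l //.
apply: le_trans le_inner; apply: ler_sum => i _; apply: ler_sum => j _.
by rewrite !to_mxE.
Qed.

Lemma rsum_le n (F G : 'I_n -> R) : (forall i, F i <= G i) -> rsum F <= rsum G.
Proof. by move=> FG; apply/RleP; apply: ler_sum => i _; apply/RleP. Qed.

Lemma rsum_ge0 n (F : 'I_n -> R) : (forall i, 0 <= F i) -> 0 <= rsum F.
Proof. by move=> F0; apply/RleP; apply: sumr_ge0 => i _; apply/RleP. Qed.

Lemma rsum_ext n (F G : 'I_n -> R) : (forall i, F i = G i) -> rsum F = rsum G.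
Proof. by move=> FG; apply: eq_bigr. Qed.

Lemma rsumD n (F G : 'I_n -> R) : rsum (fun i => F i + G i) = rsum F + rsum G.
Proof. exact: big_split. Qed.

Lemma rsumZ n c (F : 'I_n -> R) : rsum (fun i => c * F i) = c * rsum F.
Proof. by rewrite /rsum [RHS](mulr_sumr (R := R)). Qed.

Lemma rsum_term_le n (F : 'I_n -> R) i : (forall i, 0 <= F i) -> F i <= rsum F.
Proof.
move=> F0; rewrite /rsum (bigD1 i) //=.
have : 0 <= \big[Rplus/0]_(j < n | j != i) F j.
  by apply/RleP; apply: sumr_ge0 => j _; apply/RleP.
by move=> H; rewrite -[X in X <= _]Rplus_0_r; apply: Rplus_le_compat_l.
Qed.

Lemma rsum_eq0 n (F : 'I_n -> R) : (forall i, 0 <= F i) -> rsum F = 0 ->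
  forall i, F i = 0.
Proof. by move=> F0 E i; have := rsum_term_le i F0; have := F0 i; lra. Qed.

Lemma rsum_sq_le n (F : 'I_n -> R) : (forall i, 0 <= F i) ->
  rsum (fun i => F i ^ 2) <= rsum F ^ 2.
Proof.
move=> F0; have -> : rsum F ^ 2 = rsum F * rsum F by ring.
rewrite -rsumZ; apply: rsum_le => i.
have -> : F i ^ 2 = F i * F i by ring.
by apply: Rmult_le_compat_r => //; apply: rsum_term_le.
Qed.

(** The bound [c] must be nonnegative because [rmax] starts its iteration at 0. *)
Lemma rmax_leP n (F : 'I_n -> R) c : 0 <= c ->
  rmax F <= c <-> (forall i, F i <= c).
Proof.
move=> c0; split=> [|Fc].
  rewrite /rmax => H i; apply: Rle_trans H; have := mem_index_enum i.
  elim: (index_enum _) => // j s IH; rewrite inE big_cons => /orP[/eqP <-|/IH H].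
    exact: Rmax_l.
  by apply: Rle_trans H _; apply: Rmax_r.
by apply: (big_ind (fun x => x <= c)) => // x y; apply: Rmax_lub.
Qed.

Lemma esum_Fin n (F : 'I_n -> ereal) (G : 'I_n -> R) :
  (forall i, F i = Fin (G i)) -> esum F = Fin (rsum G).
Proof.
move=> FG; rewrite /esum /rsum; elim/big_rec2: _ => // i x y _ ->.
by rewrite FG.
Qed.

Lemma sqrt_sum_sq_le a b A B : 0 <= A -> 0 <= B -> a <= A ^ 2 -> b <= B ^ 2 ->
  sqrt (a + b) <= A + B.
Proof.
move=> A0 B0 aA bB; rewrite -(sqrt_pow2 (A + B)); last lra.
by apply: sqrt_le_1_alt; nra.
Qed.

End RealSums.

(** * The penalty bounds *)

Section ScalarPenalty.
Set Implicit Arguments. Unset Strict Implicit.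
Local Open Scope R_scope.
Variables (phi : R -> ereal) (tstar t0 d : R).
Hypothesis Hphi : in_Phi phi tstar.
Hypothesis Hd : is_left_deriv1 phi d.
Hypothesis Ht0 : 0 <= t0 < 1.
Hypothesis Hsub : in_subdiff (psi_of phi) t0 (1 / (1 - tstar)).

Let r t := rval (phi t).

Lemma phi_fin t : in01 t -> phi t = Fin (r t).
Proof.
move=> t01; case: Hphi => _ [_ [/(_ t t01)[e [e0 H]] _]].
have := H t; rewrite /r; case: (phi t) => //= /(_ _) H'.
by case: H' => //; rewrite Rminus_diag Rabs_R0.
Qed.

Lemma psi_of_in01 t : in01 t -> psi_of phi t = phi t.
Proof. by case=> ? ?; rewrite /psi_of; do 2!case: Rle_dec => // ?. Qed.

Lemma phi_ge0 t : in01 t -> 0 <= r t.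
Proof.
move=> t01; case: Hphi => _ [_ [_ [_ [_ [_ [/(_ t t01) H _]]]]]].
by move: H; rewrite (phi_fin t01).
Qed.

Lemma phi1 : r 1 = 1.
Proof. by case: Hphi => _ [_ [_ [_ [_ [_ [_ H]]]]]]; rewrite /r H. Qed.

Lemma phi_tstar : r tstar = 0.
Proof. by case: Hphi => _ [_ [_ [_ [_ [H _]]]]]; rewrite /r H. Qed.

Lemma tstar_bounds : 0 <= tstar < 1.
Proof. by case: Hphi => _ [_ [_ [_ [H _]]]]. Qed.

Lemma phi_convex s t th : in01 s -> in01 t -> in01 th ->
  r (th * s + (1 - th) * t) <= th * r s + (1 - th) * r t.
Proof.
move=> s01 t01 th01; case: Hphi => _ [_ [_ [/(_ s t th s01 t01 th01) H _]]].
move: H; rewrite (phi_fin s01) (phi_fin t01) phi_fin //.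
by move: s01 t01 th01; rewrite /in01; nra.
Qed.

(** By convexity the slopes of the chords ending at 1 increase towards their limit [d]. A violation
    at [t] would make the slope from [t] exceed [d] by a fixed amount, and all later slopes too. *)
Lemma phi_ge_left_tangent t : in01 t -> 1 - d * (1 - t) <= r t.
Proof.
move=> t01; case: (Req_dec t 1) => [->|t1]; first by rewrite phi1; lra.
have H0 : 0 < 1 - t by case: t01; lra.
apply: Rnot_lt_le => Hlt.
have [|dl [dl0 Hdl]] := Hd (eps := (1 - r t) / (1 - t) - d).
  suff : d < (1 - r t) / (1 - t) by lra.
  by apply: (Rmult_lt_reg_r (1 - t)) => //; rewrite Rdiv_def Rmult_assoc Rinv_l; lra.
(* Small enough for the limit to apply, while [1 - h] stays between [t] and 1. *)
pose h := Rmin (dl / 2) (1 - t).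
have h_gt0 : 0 < h by apply: Rmin_glb_lt; lra.
have h_dl : h < dl by have := Rmin_l (dl / 2) (1 - t); rewrite -/h; lra.
have h_t : h <= 1 - t by apply: Rmin_r.
have th01 : in01 (h / (1 - t)).
  split; first by apply: Rle_mult_inv_pos; lra.
  by apply: (Rmult_le_reg_r (1 - t)) => //; rewrite Rdiv_def Rmult_assoc Rinv_l; lra.
have := phi_convex t01 (_ : in01 1) th01.
have -> : h / (1 - t) * t + (1 - h / (1 - t)) * 1 = 1 - h by field; lra.
rewrite phi1 => /(_ _) conv; have {}conv := conv ltac:(split; lra).
have := Hdl h (conj h_gt0 h_dl); rewrite -/(r 1) -/(r (1 - h)) phi1 => Habs.
have slope : (1 - r t) / (1 - t) <= (1 - r (1 - h)) / h.
  apply: (Rmult_le_reg_r h) => //.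
  have -> : (1 - r (1 - h)) / h * h = 1 - r (1 - h) by field; lra.
  have -> : (1 - r t) / (1 - t) * h = h / (1 - t) * (1 - r t) by field; lra.
  by lra.
by have := Rle_abs ((1 - r (1 - h)) / h - d); lra.
Qed.

(** The tangent bound at the zero [tstar] of [phi]; it makes the denominator of [kappa] positive. *)
Lemma left_deriv_ge : 1 <= d * (1 - tstar).
Proof.
have [? ?] := tstar_bounds.
have : in01 tstar by split; lra.
by move=> /phi_ge_left_tangent; rewrite phi_tstar; lra.
Qed.

Lemma left_deriv_ge1 : 1 <= d.
Proof. by have := left_deriv_ge; have := tstar_bounds; nra. Qed.

(** Chosen so that [kappa d = (1 - t0) / (1 - tstar)], the subgradient at [t0] times the distance
    from [t0] to 1. *)
Definition kappa := (1 - t0) / (d * (1 - tstar)).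
Definition pen_min (x : R) := if Rlt_dec d x then 1 else kappa * x.

Lemma kappa_gt0 : 0 < kappa.
Proof. by apply: Rdiv_lt_0_compat; have := left_deriv_ge; lra. Qed.

Lemma kappa_le : kappa <= 1 - t0.
Proof.
have := left_deriv_ge => H.
apply: (Rmult_le_reg_r (d * (1 - tstar))); first lra.
by rewrite /kappa Rdiv_def Rmult_assoc Rinv_l; nra.
Qed.

(** This supplies the hypothesis [mu i <= x i] that pays for missing mass in the averaging
    argument. *)
Lemma pen_min_le_id x : 0 <= x -> pen_min x <= x.
Proof.
move=> x0; rewrite /pen_min; case: Rlt_dec => /= ?.
  by have := left_deriv_ge1; lra.
by have := kappa_le; nra.
Qed.

(* Below the threshold d, the subgradient 1/(1-tstar) at t0 is compared with the slope x:
   if x is smaller, phi is first scaled down by x(1-tstar) <= 1. *)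
Lemma pen_min_le x t : 0 <= x -> in01 t -> pen_min x <= r t + x * (1 - t).
Proof.
move=> x0 t01; rewrite /pen_min; case: Rlt_dec => /= [dx|xd].
  by have := phi_ge_left_tangent t01; case: t01; nra.
have [ts0 ts1] := tstar_bounds.
have dg := left_deriv_ge; have rt0 := phi_ge0 t01.
have t0in : in01 t0 by split; lra.
have r00 := phi_ge0 t0in.
set al := 1 / (1 - tstar).
have alE : al * (1 - tstar) = 1 by rewrite /al; field; lra.
have al0 : 0 < al by apply: Rdiv_lt_0_compat; lra.
have sub : r t0 + al * (t - t0) <= r t.
  case: Hsub => _ /(_ t).
  by rewrite !psi_of_in01 // (phi_fin t01) (phi_fin t0in).
have kE : kappa * d = al * (1 - t0).
  by rewrite /kappa /al; field; split; nra.
have k0 := kappa_gt0; have kle := kappa_le.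
have [t_0 t_1] := t01.
case: (Rle_lt_dec al x) => ax.
  have : kappa * x <= kappa * d by apply: Rmult_le_compat_l; lra.
  have : al * (1 - t) <= x * (1 - t) by apply: Rmult_le_compat_r; lra.
  by lra.
apply: Rle_trans (_ : x * (1 - t0) <= _); first nra.
have : al * (1 - t0) <= r t + al * (1 - t) by lra.
have : x * (1 - tstar) <= 1 by rewrite -alE; nra.
move=> xt1 Hal.
have : x * (1 - tstar) * (al * (1 - t0)) <= x * (1 - tstar) * (r t + al * (1 - t)).
  by apply: Rmult_le_compat_l => //; nra.
have -> : x * (1 - tstar) * (al * (1 - t0)) = (al * (1 - tstar)) * (x * (1 - t0)) by ring.
have -> : x * (1 - tstar) * (r t + al * (1 - t)) =
    x * (1 - tstar) * r t + (al * (1 - tstar)) * (x * (1 - t)) by ring.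
by rewrite alE; nra.
Qed.

Lemma pen_min_split rho x : pen_min (rho * x) =
  (if Rlt_dec d (rho * x) then 1 else 0) +
  kappa * rho * (if Rlt_dec d (rho * x) then 0 else x).
Proof. by rewrite /pen_min; case: Rlt_dec => /= _; ring. Qed.

Lemma sing_in01 m n (W : rmat m n) : leq m n -> specnorm W <= 1 ->
  forall i, in01 (sing W i).
Proof.
move=> mn /rmax_leP H i; split; last by apply: H; lra.
by have [_ [_ [H0 _]]] := svdP W mn; apply: H0.
Qed.

Lemma entry_abs_in01 m n (S : rmat m n) : maxabs S <= 1 ->
  forall i j, in01 (Rabs (S i j)).
Proof.
move=> /rmax_leP H i j; split; first exact: Rabs_pos.
by have /rmax_leP := H ltac:(lra) i; apply; lra.
Qed.

(** * Lower bounds for the penalized terms *)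

Lemma spectral_part_bound m n (W X : rmat m n) rho : leq m n -> 0 <= rho ->
  specnorm W <= 1 ->
  rsum (fun i => pen_min (rho * sing X i)) <=
  rsum (fun i => r (sing W i)) + rho * (nucnorm X - inner W X).
Proof.
move=> mn rho0 W1; have W01 := sing_in01 mn W1.
have [_ [_ [s0 _]]] := svdP X mn.
have x0 i : 0 <= rho * sing X i by apply: Rmult_le_pos => //; apply: s0.
apply: trace_pairing_bound => // [k|i k|i].
- exact: phi_ge0.
- exact: pen_min_le.
- exact: pen_min_le_id.
Qed.

Lemma nucnorm_ge_inner m n (W X : rmat m n) : leq m n -> specnorm W <= 1 ->
  inner W X <= nucnorm X.
Proof.
move=> mn W1; have W01 := sing_in01 mn W1.
have [_ [_ [s0 _]]] := svdP X mn.
have : rsum (fun _ : 'I_m => 0) <=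
    rsum (fun _ : 'I_m => 0) + 1 * (nucnorm X - inner W X).
  apply: trace_pairing_bound => // [|k|i k|i]; try lra.
  - by have : 0 <= sing X i := s0 i; have [] := W01 k; nra.
  - by rewrite Rmult_1_l; apply: s0.
lra.
Qed.

Lemma entry_part_bound m n (Y S : rmat m n) rho : 0 <= rho -> maxabs S <= 1 ->
  rsum (fun i => rsum (fun j => pen_min (rho * Rabs (Y i j)))) <=
  rsum (fun i => rsum (fun j => r (Rabs (S i j)))) + rho * (l1norm Y - inner Y S).
Proof.
move=> rho0 S1; have S01 := entry_abs_in01 S1.
have -> : rho * (l1norm Y - inner Y S) =
    rsum (fun i => rsum (fun j => rho * Rabs (Y i j) + - rho * (Y i j * S i j))).
  have -> : rho * (l1norm Y - inner Y S) = rho * l1norm Y + - rho * inner Y S by ring.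
  rewrite /l1norm /inner -!rsumZ -rsumD; apply: rsum_ext => i.
  by rewrite -!rsumZ -rsumD.
rewrite -rsumD; apply: rsum_le => i; rewrite -rsumD; apply: rsum_le => j.
have := pen_min_le (Rmult_le_pos _ _ rho0 (Rabs_pos (Y i j))) (S01 i j).
have := Rle_abs (Y i j * S i j); rewrite Rabs_mult => H.
have : rho * (Y i j * S i j) <= rho * (Rabs (Y i j) * Rabs (S i j)).
  exact: Rmult_le_compat_l.
lra.
Qed.

Lemma l1norm_ge_inner m n (Y S : rmat m n) : maxabs S <= 1 ->
  inner Y S <= l1norm Y.
Proof.
move=> S1; apply: rsum_le => i; apply: rsum_le => j.
have [_ ?] := entry_abs_in01 S1 i j; have ? := Rabs_pos (Y i j).
have := Rle_abs (Y i j * S i j); rewrite Rabs_mult; nra.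
Qed.

(** * Feasible completions of the truncations *)

(** [W] has the singular bases of [X], with singular value 1 on kept indices and [tstar] elsewhere.
    Since [phi] is 1 at 1 and 0 at [tstar], its sum counts the kept indices. *)
Lemma Xrho_certificate m n (X : rmat m n) rho : leq m n -> 0 <= rho ->
  exists W : rmat m n,
  [/\ specnorm W <= 1, nucnorm (Xrho d rho X) = inner W (Xrho d rho X),
      rsum (fun i => r (sing W i)) =
        rsum (fun i => if Rlt_dec d (rho * sing X i) then 1 else 0) &
      rsum (fun i => rsum (fun j => (X i j - Xrho d rho X i j) ^ 2)) <=
        rsum (fun i => if Rlt_dec d (rho * sing X i) then 0 else sing X i) ^ 2].
Proof.
move=> mn rho0; have := svdP X mn; rewrite /Xrho /sing.
case: (svd X) => [[s U] V] /= [Uo [Vo [s0 [ss XE]]]].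
have [ts0 ts1] := tstar_bounds.
pose x i := if Rlt_dec d (rho * s i) then s i else 0.
pose w i := if Rlt_dec d (rho * s i) then 1 else tstar.
rewrite -/x.
set X' := mmul _ (trmx' V); pose W := mmul (mmul U (@diag_blk m n w)) (trmx' V).
(* Kept indices form an initial segment, so [x] and [w] remain nonincreasing. *)
have mono (i j : 'I_m) : leq i j -> rho * s j <= rho * s i.
  by move=> /ss sij; apply: Rmult_le_compat_l.
have SX : is_svd X' x U V.
  split=> //; split=> //; split=> [i|]; last split=> // i j ij.
    by rewrite /x; case: Rlt_dec => /= ?; [apply: s0|lra].
  rewrite /x; have := mono _ _ ij; have := ss _ _ ij; have := s0 i.
  by do 2!case: Rlt_dec => /= ?; lra.
have SW : is_svd W w U V.
  split=> //; split=> //; split=> [i|]; last split=> // i j ij.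
    by rewrite /w; case: Rlt_dec => /= ?; lra.
  rewrite /w; have := mono _ _ ij.
  by do 2!case: Rlt_dec => /= ?; lra.
exists W; split.
- apply/rmax_leP; first lra.
  (* Only sums over [sing W] are accessible, so the bound by 1 is read off from the vanishing sum of
     the indicator [h] of values above 1. *)
  pose h t := if Rle_dec t 1 then 0 else 1.
  have h0 t : 0 <= h t by rewrite /h; case: Rle_dec => /= ?; lra.
  have E : rsum (fun i => h (sing W i)) = 0.
    rewrite (sing_rsum h mn SW) -(Rmult_0_l (rsum w)) -rsumZ.
    apply: rsum_ext => i; rewrite Rmult_0_l /h.
    have : w i <= 1 by rewrite /w; case: Rlt_dec => /= ?; lra.
    by case: Rle_dec.
  move=> i; have := rsum_eq0 (fun k => h0 (sing W k)) E i.
  by rewrite /h; case: Rle_dec => //= ? ?; lra.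
- rewrite /nucnorm (sing_rsum (fun t => t) mn SX) inner_svd_same //.
  apply: rsum_ext => i; rewrite /x /w.
  by case: Rlt_dec => /= _; rewrite -RmultE; lra.
- rewrite (sing_rsum r mn SW); apply: rsum_ext => i; rewrite /w.
  by case: Rlt_dec => /= _; rewrite ?phi1 ?phi_tstar.
(* [X - X'] has diagonal factor [c] in the same bases, so its squared Frobenius norm is the sum of
   the squares of the discarded singular values. *)
- pose c i := s i - x i.
  have -> : rsum (fun i => rsum (fun j => (X i j - X' i j) ^ 2)) =
      rsum (fun i => c i ^ 2).
    transitivity (rsum (fun i => c i * c i)%R); last by apply: rsum_ext => i; ring.
    rewrite -[RHS](inner_svd_same c c mn Uo Vo).
    apply: rsum_ext => i; apply: rsum_ext => j.
    by rewrite XE /X' mmul_diag_sub -Rsqr_pow2.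
  have cE i : c i = if Rlt_dec d (rho * s i) then 0 else s i.
    by rewrite /c /x; case: Rlt_dec => /= _; ring.
  rewrite -(rsum_ext cE); apply: rsum_sq_le => i; rewrite cE.
  by case: Rlt_dec => /= _; [lra|apply: s0].
Qed.

(** [S] is the sign of [Y] on kept entries and [tstar] elsewhere. The sign [sg] takes the value 1 at
    0, so that its absolute value is always 1. *)
Lemma Yrho_certificate m n (Y : rmat m n) rho :
  exists S : rmat m n,
  [/\ maxabs S <= 1, l1norm (Yrho d rho Y) = inner (Yrho d rho Y) S,
      rsum (fun i => rsum (fun j => r (Rabs (S i j)))) =
        rsum (fun i => rsum (fun j =>
          if Rlt_dec d (rho * Rabs (Y i j)) then 1 else 0)) &
      rsum (fun i => rsum (fun j => (Y i j - Yrho d rho Y i j) ^ 2)) <=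
        rsum (fun i => rsum (fun j =>
          if Rlt_dec d (rho * Rabs (Y i j)) then 0 else Rabs (Y i j))) ^ 2].
Proof.
have [ts0 ts1] := tstar_bounds.
pose sg y := if Rle_dec 0 y then 1 else -1.
have sg_abs y : Rabs (sg y) = 1.
  by rewrite /sg; case: Rle_dec => /= _; [rewrite Rabs_R1|rewrite Rabs_Ropp Rabs_R1].
have sg_mul y : y * sg y = Rabs y.
  by rewrite /sg; case: Rle_dec => /= ?; [rewrite Rabs_pos_eq|rewrite Rabs_left]; lra.
exists (fun i j => if Rlt_dec d (rho * Rabs (Y i j)) then sg (Y i j) else tstar); split.
- apply/rmax_leP => [|i]; first lra; apply/rmax_leP => [|j]; first lra.
  by case: Rlt_dec => /= _; rewrite ?sg_abs ?Rabs_pos_eq; lra.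
- apply: rsum_ext => i; apply: rsum_ext => j; rewrite /Yrho.
  by case: Rlt_dec => /= _; rewrite ?sg_mul // Rabs_R0; ring.
- apply: rsum_ext => i; apply: rsum_ext => j.
  by case: Rlt_dec => /= _; rewrite ?sg_abs ?phi1 // Rabs_pos_eq ?phi_tstar.
- set c := fun i j => if Rlt_dec d (rho * Rabs (Y i j)) then 0 else Rabs (Y i j).
  have c0 i j : 0 <= c i j.
    by rewrite /c; case: Rlt_dec => /= _; [lra|apply: Rabs_pos].
  apply: Rle_trans (_ : rsum (fun i => rsum (c i) ^ 2) <= _).
    apply: rsum_le => i; apply: Rle_trans (rsum_sq_le (c0 i)).
    apply: rsum_le => j; rewrite /c /Yrho; case: Rlt_dec => /= _; first lra.
    by have := Rsqr_abs (Y i j); rewrite /Rsqr; lra.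
  by apply: rsum_sq_le => i; apply: rsum_ge0.
Qed.

End ScalarPenalty.

(** * Comparison of the penalized problem with the constrained one *)

Section ExactPenalty.
Set Implicit Arguments. Unset Strict Implicit.
Local Open Scope R_scope.
Variables (n1 n2 : nat) (phi : R -> ereal) (tstar t0 d nu lam Lf : R).
Variables (f : rmat n1 n2 * rmat n1 n2 -> ereal) (Om : rmat n1 n2 * rmat n1 n2 -> Prop).
Hypothesis Hn : leq n1 n2.
Hypothesis Hphi : in_Phi phi tstar.
Hypothesis Hd : is_left_deriv1 phi d.
Hypothesis Ht0 : 0 <= t0 < 1.
Hypothesis Hsub : in_subdiff (psi_of phi) t0 (1 / (1 - tstar)).
Hypotheses (Hnu : 0 < nu) (Hlam : 0 < lam) (HLf : 0 < Lf).
Hypothesis Hlip : lipschitz_rel f Om Lf.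
Hypothesis Hrho : forall (X Y : rmat n1 n2) (rho : R), Om (X, Y) -> 0 < rho ->
  Om (Xrho d rho X, Yrho d rho Y).

Let r t := rval (phi t).

(** On the box all terms are finite: [f] by the relative Lipschitz property, [phi] because its
    arguments lie in [[0, 1]]. *)
Lemma Fobj_Fin (z : quad n1 n2) : box_feas Om z ->
  Fobj nu lam f phi z =
  Fin (nu * rval (f (zX z, zY z)) + rsum (fun i => r (sing (zW z) i)) +
       lam * rsum (fun i => rsum (fun j => r (Rabs (zS z i j))))).
Proof.
move=> [W1 [S1 Oz]]; rewrite /Fobj.
rewrite (esum_Fin (G := fun i => r (sing (zW z) i))) => [|i]; last first.
  by apply: (phi_fin Hphi); apply: sing_in01.
rewrite (esum_Fin (G := fun i => rsum (fun j => r (Rabs (zS z i j))))) => [|i].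
  by have := Hlip.1 _ Oz; case: (f _).
by apply: esum_Fin => j; apply: (phi_fin Hphi); apply: entry_abs_in01.
Qed.

Lemma cstr_ge0 (z : quad n1 n2) : box_feas Om z -> 0 <= cstr lam z.
Proof.
move=> [W1 [S1 _]]; rewrite /cstr.
have := nucnorm_ge_inner (zX z) Hn W1; have := l1norm_ge_inner (zY z) S1.
by nra.
Qed.

Let rhobar := d * (1 - tstar) * nu * Lf / ((1 - t0) * Rmin 1 lam).

Lemma Q_feasible_below (z : quad n1 n2) : box_feas Om z ->
  exists2 z', Q_feas lam Om z' &
    ele (Fobj nu lam f phi z') (Fpen nu lam rhobar f phi z).
Proof.
move=> Bz; have [W1 [S1 Oz]] := Bz.
have dts := left_deriv_ge Hphi Hd.
have min0 : 0 < Rmin 1 lam by apply: Rmin_glb_lt; lra.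
have rho0 : 0 < rhobar.
  apply: Rdiv_lt_0_compat; first by apply: Rmult_lt_0_compat => //; nra.
  by apply: Rmult_lt_0_compat; lra.
(* This identity is the reason for the value of [rhobar]; from here on only it and positivity are
   used. *)
have kr : kappa tstar t0 d * rhobar * Rmin 1 lam = nu * Lf.
  by rewrite /kappa /rhobar; field; split; [lra|split; nra].
move: rhobar rho0 kr => rho rho0 kr.
have k0 := kappa_gt0 Hphi Hd Ht0.
have [W' [W'1 W'nuc W'phi Xdist]] := Xrho_certificate d Hphi (zX z) Hn (Rlt_le _ _ rho0).
have [S' [S'1 S'l1 S'phi Ydist]] := Yrho_certificate d Hphi (zY z) rho.
set X' := Xrho d rho (zX z) in W'nuc Xdist *.
set Y' := Yrho d rho (zY z) in S'l1 Ydist *.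
have Oz' : Om (X', Y') by apply: Hrho.
pose z' : quad n1 n2 := (X', W', Y', S').
have Bz' : box_feas Om z' by [].
exists z'.
  split=> //; rewrite /cstr.
  by rewrite -[zX z']/X' -[zW z']/W' -[zY z']/Y' -[zS z']/S' W'nuc S'l1; ring.
rewrite /Fpen !Fobj_Fin //= /zX /zW /zY /zS /= -/(zX z) -/(zY z) W'phi S'phi.
have HX := spectral_part_bound Hphi Hd Ht0 Hsub (zX z) Hn (Rlt_le _ _ rho0) W1.
have HY := entry_part_bound Hphi Hd Ht0 Hsub (zY z) (Rlt_le _ _ rho0) S1.
rewrite (rsum_ext (fun i => pen_min_split tstar t0 d rho (sing (zX z) i))) in HX.
rewrite rsumD rsumZ in HX.
have HYE i : rsum (fun j => pen_min tstar t0 d (rho * Rabs (zY z i j))) =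
    rsum (fun j => if Rlt_dec d (rho * Rabs (zY z i j)) then 1 else 0) +
    kappa tstar t0 d * rho *
    rsum (fun j => if Rlt_dec d (rho * Rabs (zY z i j)) then 0 else Rabs (zY z i j)).
  by rewrite -rsumZ -rsumD; apply: rsum_ext => j; apply: pen_min_split.
rewrite (rsum_ext HYE) rsumD rsumZ in HY.
have AX0 : 0 <= rsum (fun i => if Rlt_dec d (rho * sing (zX z) i) then 0 else sing (zX z) i).
  apply: rsum_ge0 => i; have [_ [_ [s0 _]]] := svdP (zX z) Hn.
  by case: Rlt_dec => /= _; [lra|apply: s0].
have AY0 : 0 <= rsum (fun i => rsum (fun j =>
    if Rlt_dec d (rho * Rabs (zY z i j)) then 0 else Rabs (zY z i j))).
  apply: rsum_ge0 => i; apply: rsum_ge0 => j.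
  by case: Rlt_dec => /= _; [lra|apply: Rabs_pos].
have Hdist : pdist (zX z, zY z) (X', Y') <= _ := sqrt_sum_sq_le AX0 AY0 Xdist Ydist.
have fz : f (zX z, zY z) = Fin (rval (f (zX z, zY z))).
  by have := Hlip.1 _ Oz; case: (f _).
have fz' : f (X', Y') = Fin (rval (f (X', Y'))).
  by have := Hlip.1 _ Oz'; case: (f _).
have Hf := Hlip.2 _ _ _ _ Oz Oz' fz fz'.
move: AX0 AY0 Hdist HX HY Hf; rewrite /cstr.
set AX := rsum (fun i => if _ then 0 else _).
set AY := rsum (fun i => rsum (fun j => if _ then 0 else _)).
set KX := rsum (fun i => if _ then _ else _).
set KY := rsum (fun i => rsum (fun j => if _ then _ else _)).
set k := kappa _ _ _ in kr k0 *.
set PX := rsum (fun i => r _); set PY := rsum (fun i => rsum (fun j => r _)).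
set a := rval _; set b := rval _.
set cX := nucnorm _ - _; set cY := l1norm _ - _; set D := pdist _ _.
move=> AX0 AY0 Hdist HX HY Hf.
(* [AX] and [AY] are the discarded masses, which bound the distance from [(X, Y)] to its
   truncation. *)
have Hfb : nu * (b - a) <= nu * Lf * (AX + AY).
  rewrite Rmult_assoc; apply: Rmult_le_compat_l; first lra.
  apply: Rle_trans (_ : Lf * D <= _); last by apply: Rmult_le_compat_l; lra.
  by apply: Rle_trans Hf; rewrite Rabs_minus_sym; apply: Rle_abs.
have kr0 : 0 < k * rho by apply: Rmult_lt_0_compat.
(* The residual masses carry weights 1 and [lam]; the factor [Rmin 1 lam] is below both. *)
have HAX : k * rho * Rmin 1 lam * AX <= k * rho * AX.
  apply: Rmult_le_compat_r => //; have := Rmin_l 1 lam; nra.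
have HAY : k * rho * Rmin 1 lam * AY <= lam * (k * rho * AY).
  have -> : lam * (k * rho * AY) = k * rho * lam * AY by ring.
  apply: Rmult_le_compat_r => //; have := Rmin_r 1 lam; nra.
have := Rmult_le_compat_l lam _ _ (Rlt_le _ _ Hlam) HY.
rewrite -kr in Hfb; lra.
Qed.

Lemma Fpen_Fin rho (z : quad n1 n2) : box_feas Om z ->
  Fpen nu lam rho f phi z =
  Fin (rval (Fobj nu lam f phi z) + rho * cstr lam z).
Proof. by move=> Bz; rewrite /Fpen Fobj_Fin. Qed.

End ExactPenalty.

(** * Exactness of the penalty *)

Local Open Scope R_scope.


Theorem theorem5p2
  (n1 n2 : nat) (Hn : leq n1 n2)
  (phi : R -> ereal) (tstar t0 d : R)
  (Hphi : in_Phi phi tstar)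
  (Hd : is_left_deriv1 phi d)
  (Ht0 : 0 <= t0 < 1)
  (Hsub : in_subdiff (psi_of phi) t0 (1 / (1 - tstar)))
  (nu lam : R) (Hnu : 0 < nu) (Hlam : 0 < lam)
  (f : rmat n1 n2 * rmat n1 n2 -> ereal)
  (Om : rmat n1 n2 * rmat n1 n2 -> Prop)
  (Hfp : proper_fun f) (Hflsc : lsc_pair f) (HOm : closed_pairset Om)
  (Hsol : exists p, glob_opt Om
            (fun q => eadd (escale nu (f q))
                           (Fin (INR (rank q.1) + lam * l0norm q.2))) p)
  (Lf : R) (HLf : 0 < Lf) (Hlip : lipschitz_rel f Om Lf)
  (Hrho : forall (X Y : rmat n1 n2) (rho : R), Om (X, Y) -> 0 < rho ->
            Om (Xrho d rho X, Yrho d rho Y)) :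
  let rhobar := d * (1 - tstar) * nu * Lf / ((1 - t0) * Rmin 1 lam) in
  (forall z : quad n1 n2, box_feas Om z ->
     inf_le (Q_feas lam Om) (Fobj nu lam f phi) (Fpen nu lam rhobar f phi z)) /\
  (forall rho, rhobar < rho -> forall z : quad n1 n2,
     glob_opt (box_feas Om) (Fpen nu lam rho f phi) z <->
     glob_opt (Q_feas lam Om) (Fobj nu lam f phi) z).
Proof.
move=> rhobar; split=> [z Bz rr Hlt|rho Hr z].
  have [z' Qz' H] := Q_feasible_below Hn Hphi Hd Ht0 Hsub Hnu Hlam HLf Hlip Hrho Bz.
  exists z'; split=> //; move: H Hlt; rewrite -/rhobar.
  by case: (Fobj _ _ _ _ z') (Fpen _ _ _ _ _ _) => [x|] [y|] //=; lra.
have below z1 : box_feas Om z1 -> exists2 z', Q_feas lam Om z' &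
    rval (Fobj nu lam f phi z') <= rval (Fobj nu lam f phi z1) + rhobar * cstr lam z1.
  move=> Bz1.
  have [z' Qz' H] := Q_feasible_below Hn Hphi Hd Ht0 Hsub Hnu Hlam HLf Hlip Hrho Bz1.
  exists z' => //; move: H; have [_ Bz'] := Qz'.
  by rewrite (Fpen_Fin nu lam Hn Hphi Hlip _ Bz1) (Fobj_Fin nu lam Hn Hphi Hlip Bz').
have Fle z1 z2 : box_feas Om z1 -> box_feas Om z2 ->
    ele (Fobj nu lam f phi z1) (Fobj nu lam f phi z2) <->
    rval (Fobj nu lam f phi z1) <= rval (Fobj nu lam f phi z2).
  by move=> B1 B2; rewrite !(Fobj_Fin nu lam Hn Hphi Hlip) //.
split=> [[Bz Hopt]|[[cz Bz] Hopt]].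
  have cz0 := cstr_ge0 Hn Hlam Bz.
  have opt z' : Q_feas lam Om z' ->
      rval (Fobj nu lam f phi z) + rho * cstr lam z <= rval (Fobj nu lam f phi z').
    move=> [cz' Bz']; have := Hopt _ Bz'.
    by rewrite !(Fpen_Fin nu lam Hn Hphi Hlip) //= cz'; lra.
  have [z' Qz' Hz'] := below _ Bz.
  (* Optimality of [z] against [z'] gives [(rho - rhobar) cstr z <= 0], while [cstr z >= 0] and
     [rho > rhobar]. *)
  have cz : cstr lam z = 0 by have := opt _ Qz'; nra.
  split=> // z1 Qz1; apply/Fle => //; first by case: Qz1.
  by have := opt _ Qz1; rewrite cz; lra.
split=> // z1 Bz1; rewrite !(Fpen_Fin nu lam Hn Hphi Hlip) //= cz.
(* The chain is [F z <= F z' <= F z1 + rhobar cstr z1 <= F z1 + rho cstr z1]. *)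
have [z' Qz' Hz'] := below _ Bz1.
have /Fle H := Hopt _ Qz'; have {}H := H Bz (proj2 Qz').
by have := cstr_ge0 Hn Hlam Bz1; nra.
Qed.
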